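(* Let $n\ge 2$. For $j=2,3,\dots,n$, the expected number of cycles of length $j$ in the core of the screaming toes mapping of size $n$ is $$\mathbb{E}\,\tilde C_j^*(n)=\frac1j\,\frac{n_{[j]}}{(n-1)^j}.$$
   Context: Write $[n]=\{1,\dots,n\}$. For $n\ge 2$, the screaming toes mapping of size $n$ is the random mapping $f:[n]\to[n]$, $f(i)=B_i$, where $B_1,\dots,B_n$ are independent and $\mathbb{P}(B_i=j)=1/(n-1)$ for $j\in[n]\setminus\{i\}$; equivalently, $f$ is uniform over the $(n-1)^n$ mappings with no fixed points. The core of $f$ is the set of elements lying in cycles of $f$ (elements $i$ with $f^k(i)=i$ for some $k\ge1$), on which $f$ acts as a permutation. $\tilde C_j^*(n)$ is the number of cycles of length $j$ in the core. $n_{[j]}=n(n-1)\cdots(n-j+1)$ is the falling factorial. *)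

(* Defs.v *)
From HB Require Import structures.
From mathcomp Require Import all_boot all_order all_algebra.
From mathcomp Require Import all_classical all_reals all_analysis.

Set Implicit Arguments.
Unset Strict Implicit.
Unset Printing Implicit Defensive.

Local Open Scope set_scope.

(* The set [n] = {1, ..., n} is represented by 'I_n = {0, ..., n - 1}. *)

Definition core (n : nat) (f : 'I_n -> 'I_n) : {set 'I_n} :=
  [set i | `[< exists k : nat, (1 <= k)%N /\ iter k f i = i >]].

(* A cycle is identified with its set of elements. For i in the core,
   [orbit f i] lists i, f i, f (f i), ... without repetition, which is exactly
   the cycle through i; distinct elements of one cycle give the same set, hence
   are counted once. *)
Definition cycles (n : nat) (f : 'I_n -> 'I_n) : {set {set 'I_n}} :=
  [set [set x in orbit f i] | i in core f].

Definition num_cycles (n : nat) (f : 'I_n -> 'I_n) (j : nat) : nat :=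
  #|[set C in cycles f | #|C| == j]|.

Local Close Scope set_scope.
Local Open Scope classical_set_scope.
Local Open Scope ring_scope.
Local Open Scope ereal_scope.

(* Random variables with values in a set E carrying the discrete sigma-algebra:
   every subset of E is an event, and mutual independence is the product rule
   over every finite subfamily. *)
Definition discrete_RV (d : measure_display) (T : measurableType d) (E : Type)
    (X : T -> E) : Prop :=
  forall A : set E, measurable (X @^-1` A).

Definition mutually_independent (d : measure_display) (T : measurableType d)
    (R : realType) (P : probability T R) (I : finType) (E : Type)
    (X : I -> T -> E) : Prop :=
  forall (J : {set I}) (A : I -> set E),
    P (\bigcap_(i in [set` J]) (X i @^-1` A i)) =
    \prod_(i in J) P (X i @^-1` A i).

(* The random mapping itself is w |-> (i |-> B i w). *)
Record screaming_toes (d : measure_display) (T : measurableType d)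
    (R : realType) (P : probability T R) (n : nat)
    (B : 'I_n -> T -> 'I_n) : Prop := ScreamingToes {
  toes_RV : forall i, discrete_RV (B i) ;
  toes_indep : mutually_independent P B ;
  toes_law : forall i j, j != i ->
    P (B i @^-1` [set j]) = ((n%:R - 1)^-1 : R)%:E
}.

(* Main.v *)
(* Reading a cycle of length j from each of its j points gives j times the
   number of j-cycles as the number of duplicate-free j-tuples t that f sends
   entrywise to their cyclic shift. For fixed t and j > 1 this event prescribes
   j of the independent values B_i, none at its own index, so its probability is
   (n-1)^-j; linearity of expectation over the n_[j] tuples concludes. *)

Require Import Defs.
From mathcomp Require Import all_boot all_order all_algebra.
From mathcomp Require Import all_classical all_reals all_analysis.
From mathcomp Require Import measurable_realfun.

Import Order.TTheory GRing.Theory Num.Theory.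

Local Open Scope ring_scope.

Set Implicit Arguments.

Lemma coreP (n : nat) (f : 'I_n -> 'I_n) (i : 'I_n) :
  (i \in core f) = fcycle f (orbit f i).
Proof.
rewrite inE; apply/idP/idP.
  (* Entries 0 and 3 of [orbitPcycle] link the orbit being a cycle to a return [iter k.+1 f i = i];
     the successor encodes [1 <= k]. *)
  move=> /asboolP[[|k] [//] _ fki].
  by apply/(orbitPcycle 0 3); exists k.
by move=> /(orbitPcycle 0 3)[k fki]; apply/asboolP; exists k.+1.
Qed.

Lemma card_orbit_set (T : finType) (f : T -> T) (x : T) :
  #|[set y in orbit f x]| = order f x.
Proof. by rewrite cardsE (card_uniqP _) ?orbit_uniq// size_orbit. Qed.

(** The map [h] from a point to its orbit set has the [j]-cycles as its image here, and its fibre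
    over a cycle is that cycle, with [j] points. *)
Lemma card_core_order (n : nat) (f : 'I_n -> 'I_n) (j : nat) :
  #|[set x in core f | order f x == j]| = (j * num_cycles f j)%N.
Proof.
pose h x := [set y in orbit f x].
have -> : num_cycles f j = #|h @: [set x in core f | order f x == j]|.
  apply: eq_card => C; rewrite inE; apply/andP/imsetP => [[/imsetP[x xc ->]]|].
    by rewrite card_orbit_set => ox; exists x; rewrite // inE xc.
  move=> [x]; rewrite inE => /andP[xc ox] ->.
  split; last by rewrite card_orbit_set.
  by apply/imsetP; exists x.
rewrite -sum1_card (partition_big_imset h) /=.
rewrite mulnC -sum_nat_const; apply: eq_bigr => C /imsetP[x].
rewrite inE => /andP[xc /eqP ox] ->.
rewrite sum1dep_card -[RHS]ox -[RHS]card_orbit_set.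
apply: eq_card => y; rewrite !inE.
have fx : fcycle f (orbit f x) by rewrite -coreP.
apply/idP/idP => [/andP[_ /eqP] /setP/(_ y)|yx].
  by rewrite !inE in_orbit => <-.
have xx := in_orbit f x.
apply/andP; split; last first.
  apply/eqP/setP => z; rewrite !inE.
  by rewrite -fconnect_orbit (fconnect_cycle fx yx).
rewrite (eq_order_cycle fx xx yx) ox eqxx andbT.
(* Core membership was already unfolded in the goal, so [coreP] is unfolded to match. *)
have := coreP f y; rewrite inE => ->.
exact: (cycle_orbit_cycle fx).
Qed.

(** Such a tuple is the orbit of its head, so [thead] is a bijection onto the core points of order
    [j]. Positivity excludes the empty tuple, which is vacuously a cycle. *)
Lemma card_uniq_fcycle (n : nat) (f : 'I_n -> 'I_n) (j : nat) : (0 < j)%N ->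
  #|[set t : j.-tuple 'I_n | uniq t & fcycle f t]| = (j * num_cycles f j)%N.
Proof.
case: j => [//|j] _; rewrite -card_core_order.
have orbit_tuple (t : j.+1.-tuple 'I_n) : uniq t -> fcycle f t ->
    tval t = orbit f (thead t).
  case/tupleP: t => x t u c; rewrite theadE.
  by rewrite (orbitE c u (mem_head _ _)) /= eqxx rot0.
rewrite -(@card_in_imset _ _ (@thead j _)) /=; last first.
  move=> t u; rewrite !inE => /andP[ut ct] /andP[uu cu] tu.
  by apply: val_inj; rewrite /= (orbit_tuple t)// (orbit_tuple u)// tu.
apply: eq_card => x; apply/imsetP/idP => [[t]|].
  rewrite inE => /andP[ut ct] ->; rewrite inE coreP -orbit_tuple// ct.
  by rewrite -size_orbit -orbit_tuple// size_tuple eqxx.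
rewrite inE coreP => /andP[cx /eqP ox].
have sx : size (orbit f x) == j.+1 by rewrite size_orbit ox.
exists (Tuple sx); first by rewrite inE /= orbit_uniq cx.
have := in_orbit f x; rewrite /thead (tnth_nth x) /= /orbit.
(* With [order f x] written as a successor, [traject] unfolds and shows its head [x]. *)
by rewrite -orderSpred.
Qed.

Lemma fcycle_nextP (T : eqType) (f : T -> T) (p : seq T) : uniq p ->
  fcycle f p <-> (forall x, x \in p -> f x = next p x).
Proof.
move=> up; split=> [cp x xp|fp]; first exact/eqP/(next_cycle cp).
rewrite (@eq_in_cycle _ (mem p) _ (frel (next p))) ?cycle_next//.
by move=> x y xp _ /=; rewrite fp.
Qed.

(** A fixed point of [next p] would have order 1, whereas every point of [p] has order [size p]. *)
Lemma next_neq (T : finType) (p : seq T) (x : T) :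
  uniq p -> (1 < size p)%N -> x \in p -> next p x != x.
Proof.
move=> up sp xp; apply/eqP => nx.
have := order_cycle (cycle_next up) up xp.
have c1 : fcycle (next p) [:: x] by rewrite /= nx eqxx.
by rewrite (order_cycle c1)// ?mem_head//= => e; rewrite -e in sp.
Qed.

Definition fcycle_event (T : Type) (n : nat) (B : 'I_n -> T -> 'I_n)
    (t : seq 'I_n) : set T :=
  [set w | fcycle (fun i => B i w) t]%classic.

(** This is the shape to which [toes_indep] applies: one prescribed value per index of [t]. *)
Lemma fcycle_eventE (T : Type) (n : nat) (B : 'I_n -> T -> 'I_n)
    (t : seq 'I_n) : uniq t ->
  fcycle_event B t =
  (\bigcap_(i in [set` [set i in t]%SET]) (B i @^-1` [set next t i]))%classic.
Proof.
move=> ut; apply/seteqP; split => w /=.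
  by move=> /(@fcycle_nextP _ _ _ ut) h i; rewrite /= inE => /h.
by move=> h; apply/(@fcycle_nextP _ _ _ ut) => i it; apply: h; rewrite /= inE.
Qed.

Lemma measurable_fcycle_event (d : measure_display) (T : measurableType d)
    (R : realType) (P : probability T R) (n : nat) (B : 'I_n -> T -> 'I_n)
    (t : seq 'I_n) :
  screaming_toes P B -> uniq t -> measurable (fcycle_event B t).
Proof.
move=> hB ut; rewrite fcycle_eventE//; apply: fin_bigcap_measurable => // i _.
exact: (toes_RV hB).
Qed.

Lemma prob_fcycle_event (d : measure_display) (T : measurableType d)
    (R : realType) (P : probability T R) (n : nat) (B : 'I_n -> T -> 'I_n)
    (t : seq 'I_n) :
  screaming_toes P B -> uniq t -> (1 < size t)%N ->
  P (fcycle_event B t) = ((n%:R - 1) ^- size t)%:E.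
Proof.
move=> hB ut st; rewrite fcycle_eventE// (toes_indep hB).
under eq_bigr => i.
  rewrite inE => it; rewrite (toes_law hB) ?next_neq//; over.
by rewrite prodEFin prodr_const cardsE (card_uniqP ut) exprVn.
Qed.

Unset Implicit Arguments.

Theorem mainTheorem6 (d : measure_display) (T : measurableType d)
    (R : realType) (P : probability T R) (n : nat) (B : 'I_n -> T -> 'I_n)
    (hn : (2 <= n)%N) (hB : screaming_toes P B)
    (j : nat) (hj : (2 <= j <= n)%N) :
  ('E_P[(fun w => (num_cycles (fun i => B i w) j)%:R)] =
   (j%:R^-1 * ((n ^_ j)%:R / (n%:R - 1) ^+ j))%:E)%E.
Proof.
have [j1 _] := andP hj; have j0 : (0 < j)%N by exact: ltnW.
have jn0 : j%:R != 0 :> R by rewrite pnatr_eq0 -lt0n.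
pose U := [set t : j.-tuple 'I_n | uniq t].
(* The integral of a sum is computed under measurability of every summand, so
   the non-duplicate-free tuples get the empty event. *)
pose A (t : j.-tuple 'I_n) := [set w | t \in U /\ fcycle_event B t w]%classic.
have AE (t : j.-tuple 'I_n) : t \in U -> A t = fcycle_event B t.
  by move=> tU; apply/seteqP; split => w /=; [case|split].
have mA t : measurable (A t).
  have [tU|tU] := boolP (t \in U); last first.
    rewrite (_ : A t = set0)//; apply/seteqP; split => // w [].
    by rewrite (negbTE tU).
  have ut : uniq t by move: tU; rewrite inE.
  by rewrite AE//; exact: (measurable_fcycle_event _ hB ut).
have countE w : ((num_cycles (fun i => B i w) j)%:R : R) =
    j%:R^-1 * \sum_(t in U) \1_(A t) w.
  apply: (mulfI jn0); rewrite mulVKf// -natrM -card_uniq_fcycle// -sum1_card.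
  (* Tuples that are not cycles at [w] have indicator 0; the others contribute 1 each. *)
  rewrite natr_sum [RHS](bigID (fun t : j.-tuple _ => fcycle (B^~ w) t)) /=.
  rewrite [X in _ + X]big1 ?addr0 => [|t /andP[tU ct]]; last first.
    by rewrite indicE AE// memNset//; exact/negP.
  apply: eq_big => [t|t]; rewrite !inE// => /andP[ut ct].
  by rewrite indicE AE ?inE// mem_set.
(* The sum is put over the list [enum U], the form that [ge0_integral_sum] integrates termwise. *)
rewrite unlock; under eq_integral do rewrite countE -big_enum EFinM -sumEFin.
rewrite ge0_integralZl//; last 2 first.
- apply: emeasurable_sum => t.
  by apply/measurable_EFinP; exact: measurable_indic.
- by move=> w _; apply: sume_ge0 => t _; rewrite lee_fin.
rewrite ge0_integral_sum//; last first.
  by move=> t; apply/measurable_EFinP; exact: measurable_indic.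
under eq_bigr do rewrite integral_indic// setIT.
rewrite big_enum /=.
under eq_bigr => t tU.
  rewrite AE//; move: tU; rewrite inE => ut.
  rewrite (prob_fcycle_event _ hB) ?size_tuple//; over.
rewrite sumEFin -EFinM sumr_const -[_ *+ #|_|]mulr_natl.
have <- : #|U| = n ^_ j.
  rewrite -[n in RHS]card_ord -(card_uniq_tuples j predT).
  by apply: eq_card => t; rewrite !inE all_predT.
by [].
Qed.
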